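(* For every integer $n \geqslant 2$, the metric space $\mathcal{S}([n])$ isometrically embeds into $\mathcal{S}([n+1])$.
   Context: For an integer $n \geqslant 2$ let $[n] = \{1,\dots,n\}$. The metric space $\mathcal{S}([n])$ is the set of all metrics on $[n]$ modulo proportionality ($\rho \sim \rho'$ if $\rho' = c\rho$ for some real $c>0$), with metric $$d_{\mathcal{S}([n])}([\rho],[\rho']) = \log \max_{j \neq k} \frac{\rho'(j,k)}{\rho(j,k)} - \log \min_{j \neq k} \frac{\rho'(j,k)}{\rho(j,k)}.$$ *)

(* Defs.v *)
From HB Require Import structures.
From mathcomp Require Import all_boot all_order all_algebra generic_quotient.
From mathcomp Require Import boolp classical_sets reals topology exp.

Set Implicit Arguments.
Unset Strict Implicit.
Unset Printing Implicit Defensive.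

Import Order.TTheory GRing.Theory Num.Theory.

Local Open Scope ring_scope.
Local Open Scope quotient_scope.

(* The axioms are those of the factory [isMetric]; nonnegativity follows from
   symmetry and the triangle inequality, see [metric_on_gt0]. *)
Record metric_on (R : realType) (X : finType) := MetricOn {
  metric_fun :> X -> X -> R;
  metric_onxx : forall j, metric_fun j j = 0;
  metric_on_eq : forall j k, metric_fun j k = 0 -> j = k;
  metric_on_sym : forall j k, metric_fun j k = metric_fun k j;
  metric_on_triangle :
    forall j k l, metric_fun j l <= metric_fun j k + metric_fun k l }.

HB.instance Definition _ (R : realType) (X : finType) :=
  gen_eqMixin (metric_on R X).
HB.instance Definition _ (R : realType) (X : finType) :=
  gen_choiceMixin (metric_on R X).

Section Proportionality.
Context {R : realType} {X : finType}.
Implicit Types rho : metric_on R X.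

Definition proportional rho rho' : bool :=
  `[< exists2 c : R, 0 < c & forall j k, rho' j k = c * rho j k >].

Lemma proportional_refl : reflexive proportional.
Proof. by move=> rho; apply/asboolP; exists 1 => // j k; rewrite mul1r. Qed.

Lemma proportional_sym : symmetric proportional.
Proof.
suff H rho rho' : proportional rho rho' -> proportional rho' rho.
  by move=> rho rho'; apply/idP/idP; exact: H.
move=> /asboolP[c c0 h]; apply/asboolP; exists c^-1; first by rewrite invr_gt0.
by move=> j k; rewrite h mulKf// gt_eqF.
Qed.

Lemma proportional_trans : transitive proportional.
Proof.
move=> rho2 rho1 rho3 /asboolP[c c0 h] /asboolP[c' c'0 h']; apply/asboolP.
by exists (c' * c) => [|j k]; [exact: mulr_gt0|rewrite h' h mulrA].
Qed.

Canonical proportional_equiv := EquivRel proportional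
  proportional_refl proportional_sym proportional_trans.

End Proportionality.

Definition metric_space_of_metrics (R : realType) (X : finType) : Type :=
  {eq_quot @proportional R X}.

HB.instance Definition _ (R : realType) (X : finType) :=
  EqQuotient.on (metric_space_of_metrics R X).
HB.instance Definition _ (R : realType) (X : finType) :=
  Choice.on (metric_space_of_metrics R X).

Section Distance.
Context {R : realType} {X : finType}.
Implicit Types rho : metric_on R X.

(* The ratios over distinct points are positive, hence starting the maximum at
   0 and the minimum at [max_ratio] has no effect as soon as [X] has two
   points; see [max_ratioP] and [min_ratioP]. *)
Definition max_ratio rho rho' : R :=
  \big[Num.max/0]_(p : X * X | p.1 != p.2) (rho' p.1 p.2 / rho p.1 p.2).

Definition min_ratio rho rho' : R :=
  \big[Num.min/max_ratio rho rho']_(p : X * X | p.1 != p.2)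
    (rho' p.1 p.2 / rho p.1 p.2).

Definition log_ratio_dist rho rho' : R :=
  ln (max_ratio rho rho') - ln (min_ratio rho rho').

Lemma metric_on_gt0 rho j k : j != k -> 0 < rho j k.
Proof.
move=> jk; rewrite lt_neqAle; apply/andP; split.
  by apply: contraNN jk => /eqP/esym/metric_on_eq ->.
have := metric_on_triangle rho j k j.
by rewrite metric_onxx (metric_on_sym rho k j) -mulr2n pmulrn_lge0.
Qed.

Lemma ratio_gt0 rho rho' j k : j != k -> 0 < rho' j k / rho j k.
Proof. by move=> jk; rewrite divr_gt0 ?metric_on_gt0. Qed.

Lemma le_max_ratio rho rho' j k : j != k ->
  rho' j k / rho j k <= max_ratio rho rho'.
Proof.
by move=> jk; exact: (@le_bigmax_cond _ _ _ _ (j, k) (fun p => p.1 != p.2)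
  (fun p => rho' p.1 p.2 / rho p.1 p.2)).
Qed.

Lemma ge_min_ratio rho rho' j k : j != k ->
  min_ratio rho rho' <= rho' j k / rho j k.
Proof.
by move=> jk; exact: (@bigmin_le_cond _ _ _ _ (j, k) (fun p => p.1 != p.2)
  (fun p => rho' p.1 p.2 / rho p.1 p.2)).
Qed.

Lemma max_ratio_attained rho rho' (j0 k0 : X) : j0 != k0 ->
  exists j k, j != k /\ max_ratio rho rho' = rho' j k / rho j k.
Proof.
move=> jk0; rewrite /max_ratio.
rewrite (@bigmax_eq_arg _ _ _ _ (j0, k0))//; last first.
  by move=> p /(ratio_gt0 rho rho')/ltW.
by case: arg_maxP => // -[j k] /= jk _; exists j, k.
Qed.

Lemma min_ratio_attained rho rho' (j0 k0 : X) : j0 != k0 ->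
  exists j k, j != k /\ min_ratio rho rho' = rho' j k / rho j k.
Proof.
move=> jk0; rewrite /min_ratio.
rewrite (@bigmin_eq_arg _ _ _ _ (j0, k0))//; last first.
  by move=> p /(le_max_ratio rho rho').
by case: arg_minP => // -[j k] /= jk _; exists j, k.
Qed.

Lemma max_ratioP rho rho' (M : R) (j0 k0 : X) : j0 != k0 ->
  max_ratio rho rho' = M <->
  (exists j k, j != k /\ rho' j k / rho j k = M) /\
  (forall j k, j != k -> rho' j k / rho j k <= M).
Proof.
move=> jk0; split=> [<-|[[j [k [jk <-]]] hM]].
  split; last by move=> j k; exact: le_max_ratio.
  by have [j [k [jk ->]]] := max_ratio_attained rho rho' jk0; exists j, k.
apply/eqP; rewrite eq_le le_max_ratio// andbT.
by have [j' [k' [jk' ->]]] := max_ratio_attained rho rho' jk0; exact: hM.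
Qed.

Lemma min_ratioP rho rho' (m : R) (j0 k0 : X) : j0 != k0 ->
  min_ratio rho rho' = m <->
  (exists j k, j != k /\ rho' j k / rho j k = m) /\
  (forall j k, j != k -> m <= rho' j k / rho j k).
Proof.
move=> jk0; split=> [<-|[[j [k [jk <-]]] hm]].
  split; last by move=> j k; exact: ge_min_ratio.
  by have [j [k [jk ->]]] := min_ratio_attained rho rho' jk0; exists j, k.
apply/eqP; rewrite eq_le ge_min_ratio//=.
by have [j' [k' [jk' ->]]] := min_ratio_attained rho rho' jk0; exact: hm.
Qed.

Lemma log_ratio_dist_leP rho rho' (e : R) : 0 <= e ->
  log_ratio_dist rho rho' <= e <->
  (forall j k j' k', j != k -> j' != k' ->
    ln (rho' j k / rho j k) - ln (rho' j' k' / rho j' k') <= e).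
Proof.
move=> e0; split=> [he j k j' k' jk jk'|he].
  apply: le_trans he; rewrite /log_ratio_dist.
  have [j1 [k1 [jk1 Em]]] := min_ratio_attained rho rho' jk.
  have m0 : 0 < min_ratio rho rho' by rewrite Em ratio_gt0.
  have r0 := ratio_gt0 rho rho' jk; have r0' := ratio_gt0 rho rho' jk'.
  apply: lerB; rewrite ler_ln ?posrE ?le_max_ratio ?ge_min_ratio//.
  exact: lt_le_trans r0 (le_max_ratio _ _ jk).
have [[[j k] /= jk]|noff] := pselect (exists p : X * X, p.1 != p.2).
  rewrite /log_ratio_dist.
  have [j1 [k1 [jk1 ->]]] := min_ratio_attained rho rho' jk.
  have [j2 [k2 [jk2 ->]]] := max_ratio_attained rho rho' jk.
  exact: he.
rewrite /log_ratio_dist /min_ratio big_pred0 ?subrr// => p.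
by apply: contra_notF noff => p12; exists p.
Qed.

Lemma log_ratio_dist_ge0 rho rho' : 0 <= log_ratio_dist rho rho'.
Proof.
have [[[j k] /= jk]|noff] := pselect (exists p : X * X, p.1 != p.2).
  have [j1 [k1 [jk1 Em]]] := min_ratio_attained rho rho' jk.
  rewrite subr_ge0 Em ler_ln ?posrE ?ratio_gt0 ?le_max_ratio//.
  exact: lt_le_trans (ratio_gt0 rho rho' jk1) (le_max_ratio _ _ jk1).
rewrite /log_ratio_dist /min_ratio big_pred0 ?subrr// => p.
by apply: contra_notF noff => p12; exists p.
Qed.

Lemma ln_ratio_trans rho1 rho2 rho3 j k : j != k ->
  ln (rho3 j k / rho1 j k) = ln (rho2 j k / rho1 j k) + ln (rho3 j k / rho2 j k).
Proof.
move=> jk; rewrite -lnM ?posrE ?ratio_gt0//; congr ln.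
by rewrite [RHS]mulrC mulrA divfK// gt_eqF ?metric_on_gt0.
Qed.

Lemma ln_ratioC rho rho' j k : j != k ->
  ln (rho j k / rho' j k) = - ln (rho' j k / rho j k).
Proof. by move=> jk; rewrite -lnV ?posrE ?ratio_gt0// invf_div. Qed.

Lemma log_ratio_dist_sym rho rho' :
  log_ratio_dist rho rho' = log_ratio_dist rho' rho.
Proof.
suff H rho1 rho2 : log_ratio_dist rho1 rho2 <= log_ratio_dist rho2 rho1.
  by apply/le_anti; rewrite !H.
apply/log_ratio_dist_leP => [|j k j' k' jk jk'].
  exact: log_ratio_dist_ge0.
rewrite !(ln_ratioC rho2 rho1)// opprK addrC.
by have /log_ratio_dist_leP := lexx (log_ratio_dist rho2 rho1);
  apply=> //; exact: log_ratio_dist_ge0.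
Qed.

Lemma log_ratio_dist_triangle rho2 rho1 rho3 :
  log_ratio_dist rho1 rho3 <=
  log_ratio_dist rho1 rho2 + log_ratio_dist rho2 rho3.
Proof.
apply/log_ratio_dist_leP => [|j k j' k' jk jk'].
  by rewrite addr_ge0 ?log_ratio_dist_ge0.
rewrite !(ln_ratio_trans rho1 rho2 rho3)// opprD addrACA lerD//.
- by have /log_ratio_dist_leP := lexx (log_ratio_dist rho1 rho2);
    apply=> //; exact: log_ratio_dist_ge0.
- by have /log_ratio_dist_leP := lexx (log_ratio_dist rho2 rho3);
    apply=> //; exact: log_ratio_dist_ge0.
Qed.

Lemma log_ratio_dist_eq0 rho rho' :
  log_ratio_dist rho rho' = 0 <-> proportional rho rho'.
Proof.
split=> [d0|/asboolP[c c0 h]]; last first.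
  apply/eqP; rewrite eq_le log_ratio_dist_ge0 andbT.
  apply/log_ratio_dist_leP => // j k j' k' jk jk'.
  by rewrite !h !mulfK ?subrr// gt_eqF// metric_on_gt0.
have hle j k j' k' : j != k -> j' != k' ->
    ln (rho' j k / rho j k) <= ln (rho' j' k' / rho j' k').
  have : log_ratio_dist rho rho' <= 0 by rewrite d0.
  by move=> /(log_ratio_dist_leP _ _ (lexx 0)) h ? ?; rewrite -subr_le0 h.
apply/asboolP.
have [[[j0 k0] /= jk0]|noff] := pselect (exists p : X * X, p.1 != p.2).
  exists (rho' j0 k0 / rho j0 k0); first exact: ratio_gt0.
  move=> j k; have [->|jk] := eqVneq j k; first by rewrite !metric_onxx mulr0.
  have -> : rho' j0 k0 / rho j0 k0 = rho' j k / rho j k.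
    by apply: ln_inj; rewrite ?posrE ?ratio_gt0//; apply/le_anti; rewrite !hle.
  by rewrite divfK// gt_eqF ?metric_on_gt0.
exists 1 => // j k; have [->|jk] := eqVneq j k; first by rewrite !metric_onxx mulr0.
by case: noff; exists (j, k).
Qed.

Lemma log_ratio_dist_proportional rho1 rho1' rho2 rho2' :
  proportional rho1 rho1' -> proportional rho2 rho2' ->
  log_ratio_dist rho1 rho2 = log_ratio_dist rho1' rho2'.
Proof.
suff H a a' b b' : proportional a a' -> proportional b b' ->
    log_ratio_dist a b <= log_ratio_dist a' b'.
  move=> h1 h2; apply/le_anti; rewrite !H//.
  - by rewrite proportional_sym.
  - by rewrite proportional_sym.
move=> /log_ratio_dist_eq0 h1; rewrite proportional_sym => /log_ratio_dist_eq0 h2.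
have := log_ratio_dist_triangle a' a b; rewrite h1 add0r => /le_trans; apply.
by have := log_ratio_dist_triangle b' a' b; rewrite h2 addr0.
Qed.

Local Notation S := (metric_space_of_metrics R X).

Definition class_dist (x y : S) : R := log_ratio_dist (repr x) (repr y).

Lemma class_dist_pi rho rho' :
  class_dist (\pi_S rho) (\pi_S rho') = log_ratio_dist rho rho'.
Proof. by apply: log_ratio_dist_proportional; apply/eqmodP; rewrite reprK. Qed.

Fact class_distxx x : class_dist x x = 0.
Proof. exact/log_ratio_dist_eq0/proportional_refl. Qed.

Fact class_dist_positivity x y : class_dist x y = 0 -> x = y.
Proof.
by move/log_ratio_dist_eq0 => h; rewrite -[x]reprK -[y]reprK; exact/eqmodP.
Qed.

Fact class_dist_sym x y : class_dist x y = class_dist y x.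
Proof. exact: log_ratio_dist_sym. Qed.

Fact class_dist_triangle y x z :
  class_dist x z <= class_dist x y + class_dist y z.
Proof. exact: log_ratio_dist_triangle. Qed.

HB.instance Definition _ := isMetric.Build R S
  class_distxx class_dist_positivity class_dist_sym class_dist_triangle.

Lemma mdist_pi rho rho' :
  mdist (\pi_S rho) (\pi_S rho') = log_ratio_dist rho rho'.
Proof. exact: class_dist_pi. Qed.

End Distance.

(* Injectivity is automatic, since [mdist] separates points. *)
Definition isometrically_embeds (R : realType) (M N : metricType R) : Prop :=
  exists f : M -> N, forall x y, mdist (f x) (f y) = mdist x y.

(* Main.v *)
Require Import Defs.
From mathcomp Require Import all_boot all_order all_algebra.
From mathcomp Require Import reals topology.
From mathcomp Require Import generic_quotient exp.

(** A metric [rho] on [X] is extended to one more point by placing that point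
    at distance [diameter rho] from all the others.  The triangle inequality
    holds because [rho j k <= diameter rho <= 2 * diameter rho].

    The extension is isometric because the diameter is a maximum of values of
    the metric: if [m * rho <= rho' <= M * rho] then also
    [m * diameter rho <= diameter rho' <= M * diameter rho].  Hence the ratios
    created by the new point stay between the extreme ratios of the old pairs
    ([cone_ratio_bounds]), and the distance does not grow
    ([log_ratio_dist_cone_le]); it does not shrink because the old pairs are
    still there ([log_ratio_dist_restrict]).

    A map on classes is obtained by extending a representative of each class;
    the distance between classes may be computed on any representatives, so
    that the isometry property passes from metrics to classes. *)

Set Implicit Arguments.
Unset Strict Implicit.
Unset Printing Implicit Defensive.

Import Order.TTheory GRing.Theory Num.Theory.

Local Open Scope ring_scope.
Local Open Scope quotient_scope.

Section Restriction.
Context {R : realType} {X Y : finType}.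

(** The pairs of [X] are among the pairs of [Y], so that the spread of the
    ratios is taken over fewer pairs on the left. *)
Lemma log_ratio_dist_restrict (f : X -> Y) (rho rho' : metric_on R X)
    (sigma sigma' : metric_on R Y) : injective f ->
  (forall j k, sigma (f j) (f k) = rho j k) ->
  (forall j k, sigma' (f j) (f k) = rho' j k) ->
  log_ratio_dist rho rho' <= log_ratio_dist sigma sigma'.
Proof.
move=> f_inj Er Er'; apply/log_ratio_dist_leP => [|j k j' k' jk jk'].
  exact: log_ratio_dist_ge0.
rewrite -!Er -!Er'.
have /log_ratio_dist_leP := lexx (log_ratio_dist sigma sigma').
by apply; rewrite ?log_ratio_dist_ge0 ?(inj_eq f_inj).
Qed.

Section Pullback.
Variables (f : X -> Y) (f_inj : injective f) (sigma : metric_on R Y).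

Let pullback_fun j k := sigma (f j) (f k).

Fact pullback_xx j : pullback_fun j j = 0.
Proof. exact: metric_onxx. Qed.

Fact pullback_eq j k : pullback_fun j k = 0 -> j = k.
Proof. by move/metric_on_eq/f_inj. Qed.

Fact pullback_sym j k : pullback_fun j k = pullback_fun k j.
Proof. exact: metric_on_sym. Qed.

Fact pullback_triangle j k l :
  pullback_fun j l <= pullback_fun j k + pullback_fun k l.
Proof. exact: metric_on_triangle. Qed.

Definition pullback_metric : metric_on R X :=
  MetricOn pullback_xx pullback_eq pullback_sym pullback_triangle.

End Pullback.
End Restriction.

Section Cone.
Context {R : realType} {X : finType}.
Implicit Types (rho : metric_on R X) (j k l : X) (a b c : option X).

Definition diameter rho : R := \big[Num.max/0]_(p : X * X) rho p.1 p.2.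

Lemma metric_on_ge0 rho j k : 0 <= rho j k.
Proof.
have [->|jk] := eqVneq j k; first by rewrite metric_onxx.
exact/ltW/metric_on_gt0.
Qed.

Lemma le_diameter rho j k : rho j k <= diameter rho.
Proof. exact: (le_bigmax _ (fun p : X * X => rho p.1 p.2) (j, k)). Qed.

Lemma diameter_ge0 rho : 0 <= diameter rho.
Proof. exact: bigmax_ge_id. Qed.

Lemma diameter_gt0 rho j k : j != k -> 0 < diameter rho.
Proof. by move=> /(metric_on_gt0 rho)/lt_le_trans; apply; exact: le_diameter. Qed.

Lemma diameter_le rho (e : R) : 0 <= e ->
  (forall j k, j != k -> rho j k <= e) -> diameter rho <= e.
Proof.
move=> e0 he; apply: bigmax_le => // -[j k] _ /=.
by have [->|/he//] := eqVneq j k; rewrite metric_onxx.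
Qed.

Definition cone_fun rho (a b : option X) : R :=
  match a, b with
  | Some j, Some k => rho j k
  | None, None => 0
  | _, _ => diameter rho
  end.

(* Two distinct points make the diameter positive, which separates the apex
   [None] from the rest. *)
Variables (j0 k0 : X) (jk0 : j0 != k0).

Fact cone_xx rho a : cone_fun rho a a = 0.
Proof. by case: a => [j|//]; exact: metric_onxx. Qed.

Fact cone_eq rho a b : cone_fun rho a b = 0 -> a = b.
Proof.
have /gt_eqF/eqP D0 := diameter_gt0 rho jk0.
by case: a b => [j|] [k|] //= /metric_on_eq ->.
Qed.

Fact cone_sym rho a b : cone_fun rho a b = cone_fun rho b a.
Proof. by case: a b => [j|] [k|] //=; exact: metric_on_sym. Qed.

Fact cone_triangle rho a b c :
  cone_fun rho a c <= cone_fun rho a b + cone_fun rho b c.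
Proof.
have D0 := diameter_ge0 rho.
case: a b c => [j|] [k|] [l|] //=; rewrite ?addr0 ?add0r ?addr_ge0//.
- exact: metric_on_triangle.
- by rewrite lerDr metric_on_ge0.
- by rewrite (le_trans (le_diameter _ _ _))// lerDl.
- by rewrite lerDl metric_on_ge0.
Qed.

Definition cone_metric rho : metric_on R (option X) :=
  MetricOn (cone_xx rho) (cone_eq (rho := rho)) (cone_sym rho)
    (cone_triangle rho).

Lemma min_ratio_gt0 rho rho' : 0 < min_ratio rho rho'.
Proof.
have [j [k [jk ->]]] := min_ratio_attained rho rho' jk0.
exact: ratio_gt0.
Qed.

Lemma max_ratio_gt0 rho rho' : 0 < max_ratio rho rho'.
Proof. exact: lt_le_trans (ratio_gt0 rho rho' jk0) (le_max_ratio _ _ jk0). Qed.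

(** A ratio of maxima lies between the extreme ratios of the terms: bound
    each term of the one maximum by a multiple of the other maximum. *)
Lemma diameter_ratio_bounds rho rho' :
  min_ratio rho rho' <= diameter rho' / diameter rho <= max_ratio rho rho'.
Proof.
have m0 := min_ratio_gt0 rho rho'; have M0 := max_ratio_gt0 rho rho'.
have D0 := diameter_gt0 rho jk0.
rewrite ler_pdivlMr// ler_pdivrMr//; apply/andP; split.
- rewrite mulrC -ler_pdivlMr//; apply: diameter_le => [|j k jk].
    by rewrite divr_ge0 ?diameter_ge0 ?ltW.
  rewrite ler_pdivlMr// mulrC (le_trans _ (le_diameter _ j k))//.
  by rewrite -ler_pdivlMr ?metric_on_gt0// ge_min_ratio.
- apply: diameter_le => [|j k jk]; first by rewrite mulr_ge0 ?ltW.
  apply: (@le_trans _ _ (max_ratio rho rho' * rho j k)).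
    by rewrite -ler_pdivrMr ?metric_on_gt0// le_max_ratio.
  by rewrite ler_wpM2l ?le_diameter ?ltW.
Qed.

Lemma cone_ratio_bounds rho rho' a b : a != b ->
  min_ratio rho rho' <= cone_metric rho' a b / cone_metric rho a b
    <= max_ratio rho rho'.
Proof.
case: a b => [j|] [k|] //= jk; rewrite ?diameter_ratio_bounds//.
have {}jk : j != k by apply: contraNneq jk => ->.
by rewrite ge_min_ratio ?le_max_ratio.
Qed.

Lemma log_ratio_dist_cone_le rho rho' :
  log_ratio_dist (cone_metric rho) (cone_metric rho') <= log_ratio_dist rho rho'.
Proof.
apply/log_ratio_dist_leP => [|a b a' b' ab ab'].
  exact: log_ratio_dist_ge0.
have /andP[_ leM] := cone_ratio_bounds rho rho' ab.
have /andP[gem _] := cone_ratio_bounds rho rho' ab'.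
by apply: lerB; rewrite ler_ln ?posrE ?ratio_gt0 ?min_ratio_gt0 ?max_ratio_gt0.
Qed.

End Cone.

Lemma unlift_inj n (h : 'I_n) : injective (unlift h).
Proof.
move=> i j; case: (unliftP h i) => [i'|] ->; case: (unliftP h j) => [j'|] -> //.
by case=> ->.
Qed.

Theorem proposition4p6 (R : realType) (n : nat) (hn : (2 <= n)%N) :
  isometrically_embeds
    (metric_space_of_metrics R 'I_n) (metric_space_of_metrics R 'I_n.+1).
Proof.
have jk0 : Ordinal (ltnW hn) != Ordinal hn by [].
(* The last index of ['I_n.+1] serves as the apex of the cone over ['I_n]. *)
pose top : 'I_n.+1 := ord_max.
pose extend rho : metric_on R 'I_n.+1 :=
  pullback_metric (@unlift_inj _ top) (cone_metric jk0 rho).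
exists (fun x => \pi_(metric_space_of_metrics R 'I_n.+1) (extend (repr x))).
move=> x y; rewrite mdist_pi -[in RHS](reprK x) -[in RHS](reprK y) mdist_pi.
have extendE rho j k : extend rho (lift top j) (lift top k) = rho j k.
  by rewrite /= !liftK.
apply/le_anti/andP; split; last first.
  by apply: (log_ratio_dist_restrict (@lift_inj _ top)); exact: extendE.
apply: le_trans (log_ratio_dist_cone_le jk0 _ _).
exact: (log_ratio_dist_restrict (@unlift_inj _ top)).
Qed.
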